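(* Let $p$ be a prime, let $s\ge1$ and $m\ge 1$ be integers, and let $n_1,\ldots,n_{s}$ be nonnegative integers with $n_s\ge 1$. Let $H$ be an $m\times(n_1+2n_2+\cdots+sn_s)$ matrix of rank $m$ over $\mathbb{F}_p$, and let $C$ be the null-space of $H$, so that $C$ is an additive code in $(\mathbb{F}_p^1)^{n_1}\times\cdots\times(\mathbb{F}_p^s)^{n_s}$. Denote $$k=\sum_{i=1}^s n_i(p^s-p^{s-i})=p^s\sum_{i=1}^s n_i(1-p^{-i}),\qquad \mu=\frac{k}{p^m-1},\qquad q_i=p^i .$$ The following assertions are equivalent: (i) $C$ is an $\mathrm{OA}(|C|,q_1^{n_1}q_2^{n_2}\ldots q_s^{n_s},t)$, for some $t$, attaining the generalized Bierbrauer--Friedman bound, i.e. with $$|C|=q_1^{n_1}q_2^{n_2}\cdots q_s^{n_s}\Big(1-\big(1-\tfrac1q\big)\tfrac{n}{t+1}\Big),$$ where $n=n_1+\cdots+n_s$ and $\frac1q=\frac1n\sum_{i=1}^s\frac{n_i}{q_i}$; (i') $C$ is an $\mathrm{OA}(|C|,q_1^{n_1}q_2^{n_2}\ldots q_s^{n_s},t)$ with $t=\frac{\mu+k}{p^s}-1$; (ii) $C$ is a $\{k;\mu\}$-CR code in the graph $H(q_1^{n_1}q_2^{n_2}\ldots q_s^{n_s})$; (iii) the code $C^\perp$ generated by the rows of $H$ is an alphabet-effective one-weight code of weight $\mu p^{m-s}$; (iv) the multiset $M$ of subspaces of $\mathbb{F}_p^m$ in which, for each $i\in\{1,\ldots,s\}$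 and $j\in\{1,\ldots,n_i\}$, the subspace $H_{i,j}$ is included $p^{s-i}$ times, is a $\mu$-fold partition of $\mathbb{F}_p^m$; (v) the collection (multiset) $M^\perp=\{H_{i,j}^\perp: i=1,\ldots,s,\ j=1,\ldots,n_i\}$ of subspaces dual to the $H_{i,j}$ is a $\nu$-fold partition of $\mathbb{F}_p^m$, where $\nu=n_1+\cdots+n_s-p^{m-s}\mu$.
   Context: Blocks: the coordinates of $(\mathbb{F}_p^1)^{n_1}\times\cdots\times(\mathbb{F}_p^s)^{n_s}$, as well as the columns of $H$, are divided into $n_1+\cdots+n_s$ consecutive blocks: first $n_1$ blocks of size $1$, then $n_2$ blocks of size $2$, and so on. $H_{i,j}\subseteq\mathbb{F}_p^m$ is the subspace spanned by the columns of $H$ in the $j$th block of size $i$. For a subspace $U\subseteq\mathbb{F}_p^m$, $U^\perp$ is its dual (orthogonal complement with respect to the standard bilinear form). Additive code: a subset of $(\mathbb{F}_p^1)^{n_1}\times\cdots\times(\mathbb{F}_p^s)^{n_s}$ closed under coordinatewise addition, i.e. an $\mathbb{F}_p$-subspace. An additive code is one-weight of weight $w$ if every nonzero codeword has exactly $w$ nonzero blocks. It is alphabet-effective if in each block every element of the corresponding alphabet $\mathbb{F}_p^i$ occurs in some codeword. A multiset $D$ of subspaces of a vector space $S$ is a $\mu$-fold partition of $S$ if every nonzero vector of $S$ belongs to exactly $\mu$ subspaces from $D$, counted with multiplicity. (If $\mu$ is not a nonnegative integer, no such multiset exists.) The set $[p^i]=\{0,\ldots,p^i-1\}$ is identified with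 $\mathbb{F}_p^i$. Each block is regarded as one coordinate of a word, with alphabet $\mathbb F_p^i$ of size $q_i=p^i$ for a block of size $i$; the words thus have $n=n_1+\cdots+n_s$ coordinates. Orthogonal array: a nonempty multiset $C$ of words in a product $V$ of $n$ finite alphabets is an orthogonal array of strength $t$ ($t$ an integer, $0\le t\le n$) if for any $t$ distinct coordinates and any prescribed symbols in them, the number (with multiplicity) of words of $C$ having the prescribed symbols in those coordinates equals $|C|$ divided by the product of the sizes of the $t$ alphabets. It is denoted $\mathrm{OA}(|C|,q_1^{n_1}\ldots q_s^{n_s},t)$ when there are $n_i$ alphabets of size $q_i$ for each $i$. The multigraph $H(q_1^{n_1}\ldots q_s^{n_s})$ has as vertices all words of $(\mathbb{F}_p^1)^{n_1}\times\cdots\times(\mathbb{F}_p^s)^{n_s}$; two words are joined by an edge of multiplicity $p^{s-i}$ if they differ in exactly one block and that block has size $i$; all other pairs are non-adjacent. It is regular of degree $k$ (edges counted with multiplicity). $\{b;c\}$-CR code (completely regular code with covering radius $1$), where $b,c>0$: a set $C$ of vertices of a regular multigraph with vertex set $V$ such that every vertex in $C$ is connected with $V\setminus C$ by exactly $b$ edges and every vertex in $V\setminus C$ is connected with $C$ by exactly $c$ edges (with multiplicity). *)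

(* Defs.v *)
From HB Require Import structures.
From mathcomp Require Export all_boot all_order all_algebra.

Set Implicit Arguments.
Unset Strict Implicit.
Unset Printing Implicit Defensive.

Import GRing.Theory.
Local Open Scope ring_scope.

(* The numbers n_1, ..., n_s are the values n 1, ..., n s of n : nat -> nat;
   the other values of n are never used. *)

(* n_1 + 2 n_2 + ... + s n_s, arranged as a nested sum so that the library's
   submxrow cuts a matrix with len s n columns into consecutive blocks, first
   n 1 blocks of width 1, then n 2 blocks of width 2, and so on. *)
Definition len (s : nat) (n : nat -> nat) : nat :=
  (\sum_(i < s) \sum_(j < n i.+1) i.+1)%N.

(* The pair (i, j) stands for the (j+1)-th block of size i+1. *)
Definition block (s : nat) (n : nat -> nat) : finType :=
  {i : 'I_s & 'I_(n i.+1)}.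

Definition bsize s n (b : block s n) : nat := (tag b).+1.

Definition blk (T : Type) s n r (A : 'M[T]_(r, len s n)) (b : block s n) :
    'M[T]_(r, bsize b) :=
  submxrow (submxrow (A : 'M[T]_(r, \sum_(i < s) \sum_(j < n i.+1) i.+1))
                     (tag b))
           (tagged b).

(* Concatenation of the blocks identifies a word of
   (F_p^1)^{n_1} x ... x (F_p^s)^{n_s} with a row vector. *)
Definition word (p s : nat) (n : nat -> nat) : finType := 'rV['F_p]_(len s n).

Section Words.
Variables (p s : nat) (n : nat -> nat).
Implicit Types (C : {set word p s n}).

(* The multiset of words is given by its multiplicity function; prescribing
   symbols in the coordinates T means prescribing the restriction to T of some
   word a. *)
Definition orthogonal_array (mult : word p s n -> nat) (t : nat) : Prop :=
  let card := (\sum_x mult x)%N in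
  [/\ (0 < card)%N, (t <= #|block s n|)%N &
    forall T : {set block s n}, #|T| = t ->
    forall a : word p s n,
      (\sum_(x | [forall b in T, blk x b == blk a b]) mult x)%:R
        = card%:R / (\prod_(b in T) p ^ bsize b)%:R :> rat].

Definition is_OA C (t : nat) : Prop :=
  orthogonal_array (fun x => nat_of_bool (x \in C)) t.

(* Edge multiplicity in the multigraph: the sum has at most one term, the one
   for the unique block in which x and y differ. *)
Definition hamming_edges (x y : word p s n) : nat :=
  (\sum_(b | [set b' | blk x b' != blk y b'] == [set b])
     p ^ (s - bsize b))%N.

Definition one_weight C (w : rat) : Prop :=
  forall x, x \in C -> x != 0 ->
    #|[set b : block s n | blk x b != 0]|%:R = w.

Definition alphabet_effective C : Prop :=
  forall (b : block s n) (a : 'rV['F_p]_(bsize b)),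
    exists2 x, x \in C & blk x b = a.

End Words.

Definition regular_multigraph (V : finType) (e : V -> V -> nat) : Prop :=
  exists d : nat, forall x, (\sum_y e x y)%N = d.

(* b and c are rational so that the notion makes sense (and is false) for
   non-integral parameters. *)
Definition CR_code (V : finType) (e : V -> V -> nat) (C : {set V})
    (b c : rat) : Prop :=
  [/\ regular_multigraph e, 0 < b /\ 0 < c,
      forall x, x \in C -> (\sum_(y | y \notin C) e x y)%:R = b &
      forall x, x \notin C -> (\sum_(y in C) e x y)%:R = c].

Definition fold_partition (F : fieldType) (V : vectType F) (S : {vspace V})
    (D : seq {vspace V}) (mu : rat) : Prop :=
  (forall U, U \in D -> (U <= S)%VS) /\
  (forall v, v \in S -> v != 0 ->
     (count (fun U : {vspace V} => v \in U) D)%:R = mu).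

Definition dual_space p m (U : {vspace 'cV['F_p]_m}) : {vspace 'cV['F_p]_m} :=
  (\bigcap_(u : 'cV['F_p]_m | u \in U) lker (linfun (mulmx u^T)))%VS.

Lemma mem_dual_space p m (U : {vspace 'cV['F_p]_m}) (v : 'cV['F_p]_m) :
  v \in dual_space U <-> (forall u, u \in U -> u^T *m v = 0).
Proof.
rewrite memvE; split=> [/subv_bigcapP vU u uU | vU].
  by have := vU u uU; rewrite -memvE memv_ker lfunE => /eqP.
by apply/subv_bigcapP => u uU; rewrite -memvE memv_ker lfunE /= vU.
Qed.

Section MatrixCodes.
Variables (p s m : nat) (n : nat -> nat) (H : 'M['F_p]_(m, len s n)).

Definition null_code : {set word p s n} := [set x | H *m x^T == 0].

Definition row_code : {set word p s n} := [set x | (x <= H)%MS].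

Definition block_space (b : block s n) : {vspace 'cV['F_p]_m} :=
  <<[seq col l (blk H b) | l <- enum 'I_(bsize b)]>>%VS.

Definition space_multiset : seq {vspace 'cV['F_p]_m} :=
  flatten [seq nseq (p ^ (s - bsize b)) (block_space b)
          | b <- enum (block s n)].

Definition dual_multiset : seq {vspace 'cV['F_p]_m} :=
  [seq dual_space (block_space b) | b <- enum (block s n)].

End MatrixCodes.

Section Numbers.
Variables (p s m : nat) (n : nat -> nat).

Definition blocks : nat := (\sum_(1 <= i < s.+1) n i)%N.

Definition degree : nat :=
  (\sum_(1 <= i < s.+1) n i * (p ^ s - p ^ (s - i)))%N.

Definition mu : rat := degree%:R / (p%:R ^+ m - 1).

(* p^{m-s}; the exponent may be negative *)
Definition pms : rat := p%:R ^ (m%:Z - s%:Z).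

Definition nu : rat := blocks%:R - pms * mu.

(* 1/q, where q is the harmonic mean of the n alphabet sizes *)
Definition inv_q : rat :=
  blocks%:R^-1 * \sum_(1 <= i < s.+1) (n i)%:R / (p ^ i)%:R.

Definition BF_bound (t : nat) : rat :=
  (\prod_(1 <= i < s.+1) (p ^ i) ^ n i)%:R
    * (1 - (1 - inv_q) * (blocks%:R / t.+1%:R)).

End Numbers.

(* Main.v *)
(** For y in F_p^m, block b of the word yH vanishes exactly when y is orthogonal
    to the column space H_b of that block.  So the weight of yH counts the H_b
    not orthogonal to y, which identifies (iii) with (v); summing the weights
    over all y shows that a constant weight forces every H_b to have full
    dimension.  The multiplicities of the H_b at the nonzero vectors and those
    of the duals are exchanged by Poisson summation, carried out here without
    characters by counting pairs of orthogonal vectors; this gives (iv) <-> (v).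
    A word at syndrome -h is joined to C through block b iff h lies in H_b,
    which gives (ii) <-> (iv).  Finally the null space has strength t iff every
    nonzero yH has weight greater than t, and the bound says that t + 1 is the
    largest possible average of these weights, so all of them are equal to it. *)

Require Import Defs.
From mathcomp Require Import all_boot all_order all_algebra.
From mathcomp Require Import mxabelem ring lra.

Set Implicit Arguments.
Unset Strict Implicit.
Unset Printing Implicit Defensive.

Import Order.TTheory GRing.Theory Num.Theory.
Local Open Scope ring_scope.

(** * Orthogonality counts for weighted families of subspaces *)

Section SubspaceCounting.
Variables (F : finFieldType) (m : nat).
Local Notation q := #|F|.

Lemma rank_neq0_le1 r c (A : 'M[F]_(r, c)) :
  (\rank A <= 1)%N -> \rank A = (A != 0).
Proof. by rewrite -mxrank_eq0; case: (\rank A) => [|[]]. Qed.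

Lemma card_submx r (K : 'M[F]_(r, m)) :
  #|[set y : 'rV_m | (y <= K)%MS]| = (q ^ \rank K)%N.
Proof. by rewrite -card_rowg; apply: eq_card => y; rewrite !inE. Qed.

Lemma card_left_kernel c (A : 'M[F]_(m, c)) :
  #|[set y : 'rV_m | y *m A == 0]| = (q ^ (m - \rank A))%N.
Proof.
rewrite -mxrank_ker -card_submx.
by apply: eq_card => y; rewrite !inE sub_kermx.
Qed.

(** On the row space of [K] the functional [y *m h] is either zero or has a hyperplane as kernel;
    the product form avoids dividing by q. *)
Lemma card_submx_orthogonal r (K : 'M[F]_(r, m)) (h : 'cV[F]_m) :
  (#|[set y : 'rV_m | (y <= K)%MS && (y *m h == 0%R)]|
     * (if K *m h == 0%R then 1 else q) = q ^ \rank K)%N.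
Proof.
have ->: [set y : 'rV_m | (y <= K)%MS && (y *m h == 0)]
       = [set y : 'rV_m | (y <= K :&: kermx h)%MS].
  by apply/setP => y; rewrite !inE sub_capmx sub_kermx.
rewrite card_submx -(mxrank_mul_ker K h) expnD mulnC; congr (_ * _)%N.
by rewrite (rank_neq0_le1 (rank_leq_col _)); case: ifP => //=; rewrite expn1.
Qed.

Lemma sumr_const_nonzero (A : {set 'rV[F]_m}) (f : 'rV[F]_m -> rat) (c : rat) :
    0 \in A -> (forall y, y != 0 -> f y = c) ->
  \sum_(y in A) f y = f 0 + (#|A|%:R - 1) * c.
Proof.
move=> A0 fc; rewrite (bigD1 0) //=; congr (_ + _).
rewrite (eq_bigr (fun=> c)) => [|y /andP[_ /fc //]].
rewrite sumr_const -[c *+ _]mulr_natl (cardsD1 0 A) A0 mulrSr addrK.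
by congr (_%:R * _); apply: eq_card => y; rewrite !inE andbC.
Qed.

Variables (I : finType) (r : I -> nat) (K : forall b, 'M[F]_(r b, m)).
Variables (w : I -> rat) (c : rat).
Hypothesis cover : forall y : 'rV_m, y != 0 -> \sum_(b | (y <= K b)%MS) w b = c.

(** Double counting, weighted by [w], of pairs (b, y) with y in K_b and y orthogonal to h. Each
    nonzero y contributes c, while y = 0 lies in every K_b. *)
Lemma sum_cover_orthogonal (h : 'cV[F]_m) :
  \sum_b w b * q%:R ^+ \rank (K b) / (if K b *m h == 0 then 1%N else q)%:R
    = \sum_b w b + (#|[set y : 'rV[F]_m | y *m h == 0]|%:R - 1) * c.
Proof.
have A0 : 0 \in [set y : 'rV[F]_m | y *m h == 0] by rewrite inE mul0mx.
have := sumr_const_nonzero A0 cover.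
have ->: \sum_(b | ((0 : 'rV_m) <= K b)%MS) w b = \sum_b w b.
  by apply: eq_bigl => b; rewrite sub0mx.
move=> <-.
rewrite (exchange_big_dep xpredT) //=; apply: eq_bigr => b _.
rewrite -natrX -(card_submx_orthogonal (K b) h).
set d := (if _ then _ else _); have d0 : d%:R != 0 :> rat.
  rewrite pnatr_eq0 -lt0n /d; case: ifP => // _.
  exact: ltnW (card_finNzRing_gt1 F).
rewrite natrM mulrA mulfK // mulr_natr -sumr_const.
by apply: eq_bigl => y; rewrite !inE andbC.
Qed.

(* Poisson summation: the cover is c plus a multiple of the indicator of 0,
   so the transform of its deviation from c is constant. *)
Lemma dual_cover (h : 'cV[F]_m) : h != 0 ->
  \sum_(b | K b *m h == 0) w b * q%:R ^+ \rank (K b) = \sum_b w b - c.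
Proof.
move=> h0.
have m0 : (0 < m)%N.
  by apply: leq_trans (rank_leq_row h); rewrite lt0n mxrank_eq0.
have q1 : 1 < q%:R :> rat by rewrite ltr1n card_finNzRing_gt1.
have := sum_cover_orthogonal h; have := sum_cover_orthogonal 0.
under eq_bigr do rewrite mulmx0 eqxx divr1.
set S := \sum_b w b * q%:R ^+ \rank (K b); set W := \sum_b w b.
have ->: #|[set y : 'rV[F]_m | y *m (0 : 'cV_m) == 0]| = (q ^ m)%N.
  by rewrite card_left_kernel mxrank0 subn0.
set D := \sum_(b | K b *m h == 0) _ => ES.
have ->: \sum_b w b * q%:R ^+ \rank (K b)
    / (if K b *m h == 0 then 1%N else q)%:R = D + (S - D) / q%:R.
  have ->: S = D + \sum_(b | K b *m h != 0) w b * q%:R ^+ \rank (K b).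
    exact: bigID.
  rewrite (addrAC D _ (- D)) subrr add0r mulr_suml.
  rewrite (bigID (fun b => K b *m h == 0)) /=.
  congr (_ + _); first by apply: eq_bigr => b ->; rewrite divr1.
  by apply: eq_bigr => b /negPf ->.
have := card_left_kernel h.
rewrite (rank_neq0_le1 (rank_leq_col _)) h0 => -> /=.
move: ES; rewrite -{1}(prednK m0) subn1 expnS natrM.
set X := (q ^ m.-1)%:R; move: q1; set Q := q%:R => q1 ES E.
(* Subtracting the count for 0 from q times the count for h eliminates both S and the power of q. *)
have: D * (Q - 1) = (W - c) * (Q - 1).
  have: Q * (D + (S - D) / Q) = Q * (W + (X - 1) * c) by rewrite E.
  have Q0 : Q != 0 by lra.
  rewrite mulrDr mulrCA divff // mulr1 ES => E'; lra.
by apply: mulIf; lra.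
Qed.

End SubspaceCounting.

(** * Block calculus by matrix algebra *)

Section Blocks.
Variables (s : nat) (n : nat -> nat).
Implicit Type b : block s n.

Lemma bsize_le b : (bsize b <= s)%N.
Proof. exact: ltn_ord. Qed.

Lemma big_block (R : Type) (idx : R) (op : Monoid.com_law idx)
    (G : nat -> R) :
  \big[op/idx]_(b : block s n) G (bsize b)
    = \big[op/idx]_(1 <= i < s.+1) \big[op/idx]_(j < n i) G i.
Proof.
rewrite big_add1 /= big_mkord.
by rewrite (@sig_big_dep _ _ _ _ (fun i : 'I_s => 'I_(n i.+1)) xpredT
  (fun _ => xpredT) (fun i j => G i.+1)).
Qed.

Lemma card_block : #|block s n| = blocks s n.
Proof.
rewrite -sum1_card (big_block _ (fun=> 1%N)); apply: eq_bigr => i _.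
by rewrite sum_nat_const card_ord muln1.
Qed.

Lemma sum_bsize : (\sum_(b : block s n) bsize b)%N = len s n.
Proof.
by rewrite (big_block _ id) /len big_add1 big_mkord.
Qed.

Lemma blk_inj T r (A B : 'M[T]_(r, len s n)) :
  (forall b, blk A b = blk B b) -> A = B.
Proof.
move=> AB; apply/mxrowP => i; apply/mxrowP => j.
exact: AB (Tagged (fun i : 'I_s => 'I_(n i.+1)) j).
Qed.

Section Ring.
Variable R : comPzRingType.

(** Right multiplication by [proj b] extracts block b; its transpose embeds a symbol as a word
    supported on block b. *)
Definition proj b : 'M[R]_(len s n, bsize b) := blk 1%:M b.

Lemma blkE r (A : 'M[R]_(r, len s n)) b : blk A b = A *m proj b.
Proof. by rewrite /proj /blk !mul_submxrow mulmx1. Qed.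

Lemma blkM r t (A : 'M[R]_(r, t)) (B : 'M[R]_(t, len s n)) b :
  blk (A *m B) b = A *m blk B b.
Proof. by rewrite !blkE mulmxA. Qed.

Lemma blk0 r b : blk (0 : 'M[R]_(r, len s n)) b = 0.
Proof. by rewrite blkE mul0mx. Qed.

Lemma blkD r (A B : 'M[R]_(r, len s n)) b : blk (A + B) b = blk A b + blk B b.
Proof. by rewrite !blkE mulmxDl. Qed.

Lemma blk_tr_proj b : blk (proj b)^T b = 1%:M.
Proof.
apply/matrixP => l l'; rewrite !mxE (inj_eq (@tagnat.rank_inj _ _)) eq_Tagged.
by rewrite (inj_eq (@tagnat.rank_inj _ _)) eq_Tagged eq_sym.
Qed.

Lemma blk_tr_proj_neq b b' : b' != b -> blk (proj b)^T b' = 0.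
Proof.
move=> b'b; apply/matrixP => l l'; rewrite !mxE; case: eqP => // /(congr1 val).
move/eqP; rewrite /= tagnat.eq_Rank => /andP[].
case: b b' l l' b'b => [i j] [i' j'] /= l l' b'b /eqP ii'; subst i'.
rewrite tagnat.eq_Rank => /andP[/eqP jj' _].
by rewrite jj' eqxx in b'b.
Qed.

Lemma blk_decomp r (A : 'M[R]_(r, len s n)) :
  A = \sum_b blk A b *m (proj b)^T.
Proof.
apply: blk_inj => b.
rewrite [RHS]blkE mulmx_suml (bigD1 b) //= big1 ?addr0 => [|b' b'b].
  by rewrite -mulmxA -blkE blk_tr_proj mulmx1.
by rewrite -mulmxA -blkE blk_tr_proj_neq ?mulmx0 // eq_sym.
Qed.

Lemma mulmx_tr_blk (x y : 'rV[R]_(len s n)) :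
  x *m y^T = \sum_b blk x b *m (blk y b)^T.
Proof.
rewrite {1}[x]blk_decomp mulmx_suml; apply: eq_bigr => b _.
by rewrite -mulmxA -trmx_mul -blkE.
Qed.

End Ring.
End Blocks.

(** If [A] is listed before its complement, the first t entries contain it. This enlarges the
    support of a light word to exactly t coordinates. *)
Lemma superset_card (T : finType) (A : {set T}) (t : nat) :
  (#|A| <= t <= #|T|)%N -> exists2 B : {set T}, A \subset B & #|B| = t.
Proof.
case/andP=> At tT; pose e := enum A ++ enum (~: A).
have ue : uniq e.
  rewrite cat_uniq !enum_uniq andbT /=; apply/hasPn => x.
  by rewrite !mem_enum inE.
exists [set x in take t e].
  apply/subsetP => x xA; rewrite inE /e take_cat -cardE ltnNge At /=.
  by rewrite mem_cat mem_enum xA.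
rewrite cardsE (card_uniqP (take_uniq t ue)) size_takel //.
by rewrite size_cat -!cardE cardsC.
Qed.

(** * Words vanishing on prescribed blocks *)

Section VanishingWords.
Variables (F : finFieldType) (s : nat) (n : nat -> nat).
Implicit Type S : {set block s n}.

(** The embedded blocks are in direct sum: a word supported on block b is determined by that block,
    and words from the other summands vanish there. *)
Lemma mxrank_sum_tr_proj S :
  \rank (\sum_(b in S) <<(proj F b)^T>>)%MS = (\sum_(b in S) bsize b)%N.
Proof.
have rk b : \rank <<(proj F b)^T>>%MS = bsize b.
  rewrite mxrank_gen; apply/eqP; rewrite -/(row_free _); apply/row_freeP.
  by exists (proj F b); rewrite -blkE blk_tr_proj.
rewrite (mxdirectP _) /=; first by apply: eq_bigr => b _; rewrite rk.
apply/mxdirect_sumsP => b bS; apply/eqP.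
set X := (_ :&: _)%MS.
have /submxP[Y XY]: (X <= (proj F b)^T)%MS.
  by rewrite (submx_trans (capmxSl _ _)) ?genmxE.
have : (X <= kermx (proj F b))%MS.
  apply: submx_trans (capmxSr _ _) _; apply/sumsmx_subP => b' /andP[_ b'b].
  by rewrite genmxE sub_kermx -blkE blk_tr_proj_neq // eq_sym.
rewrite sub_kermx XY -mulmxA -blkE blk_tr_proj mulmx1 => /eqP ->.
by rewrite mul0mx.
Qed.

(** These words form the sum of the embedded blocks outside [S], whose dimension is the total size
    of those blocks. *)
Lemma card_vanishing S :
  (#|[set x : 'rV[F]_(len s n) | [forall b in S, blk x b == 0%R]]|
     * \prod_(b in S) #|F| ^ bsize b = #|F| ^ len s n)%N.
Proof.
have ->: [set x : 'rV[F]_(len s n) | [forall b in S, blk x b == 0]]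
   = [set x : 'rV[F]_(len s n) | (x <= \sum_(b in ~: S) <<(proj F b)^T>>)%MS].
  apply/setP => x; rewrite !inE; apply/'forall_implyP/idP => [xS | xS b bS].
    rewrite [x]blk_decomp; apply: summx_sub => b _.
    have [/xS/eqP-> | bS] := boolP (b \in S); first by rewrite mul0mx sub0mx.
    rewrite (submx_trans (submxMl _ _)) // (sumsmx_sup b) ?inE ?genmxE //.
  rewrite blkE -sub_kermx (submx_trans xS) //.
  apply/sumsmx_subP => b'; rewrite inE => b'S.
  rewrite genmxE sub_kermx -blkE blk_tr_proj_neq //.
  by apply: contraNneq b'S => <-.
rewrite card_submx mxrank_sum_tr_proj -expn_sum -expnD -sum_bsize.
congr (_ ^ _)%N.
rewrite addnC [RHS](bigID (mem S)) /=; congr (_ + _)%N.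
by apply: eq_bigl => b; rewrite inE.
Qed.

End VanishingWords.

(** * Strength of the null space and weights of the row code *)

Section DualDistance.
Variables (p s m : nat) (n : nat -> nat) (H : 'M['F_p]_(m, len s n)).
Local Notation C := (null_code H).

Definition weight (x : word p s n) : nat := #|[set b | blk x b != 0]|.

Lemma mem_null_code (x : word p s n) : (x \in C) = (x *m H^T == 0).
Proof. by rewrite inE -trmx_eq0 trmx_mul trmxK. Qed.

Lemma null_codeD (x y : word p s n) : x \in C -> (x + y \in C) = (y \in C).
Proof. by rewrite !mem_null_code mulmxDl => /eqP ->; rewrite add0r. Qed.

Lemma null_code_gt0 : (0 < #|C|)%N.
Proof. by apply/card_gt0P; exists 0; rewrite mem_null_code mul0mx. Qed.

(** A linear system is solvable unless some relation among its columns obstructs it; here an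
    obstruction would yield a nonzero word yH supported in [T]. *)
Lemma null_code_extend (T : {set block s n}) (a : word p s n) :
    (forall y : 'rV_m, y *m H != 0 -> (#|T| < weight (y *m H))%N) ->
  exists2 x, x \in C & forall b, b \in T -> blk x b = blk a b.
Proof.
move=> HT.
(* [D] keeps the blocks in [T] and erases the others, so agreement on [T] reads x D = a D. *)
pose D : 'M['F_p]_(len s n) := \sum_(b in T) proj _ b *m (proj _ b)^T.
have DT : D^T = D.
  by rewrite raddf_sum; apply: eq_bigr => b _; rewrite /= trmx_mul trmxK.
have blkDT b : b \in T -> D *m proj _ b = proj _ b.
  move=> bT; rewrite mulmx_suml (bigD1 b) //= big1 ?addr0 => [|b' /andP[_ b'b]].
    by rewrite -mulmxA -blkE blk_tr_proj mulmx1.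
  by rewrite -mulmxA -blkE blk_tr_proj_neq ?mulmx0 // eq_sym.
have blkDC b : b \notin T -> D *m proj _ b = 0.
  move=> bT; rewrite mulmx_suml big1 // => b' b'T.
  rewrite -mulmxA -blkE blk_tr_proj_neq ?mulmx0 //.
  by apply: contraNneq bT => ->.
suff /submxP[x]: (row_mx 0 (a *m D) <= row_mx H^T D)%MS.
  rewrite mul_mx_row => /eq_row_mx[xH xD].
  exists x => [|b bT]; first by rewrite mem_null_code -xH.
  by rewrite !blkE -(blkDT b bT) !mulmxA xD.
(* The cokernel collects the column relations; [U] and [V] are their coefficients on the columns of
   [H^T] and of [D]. *)
rewrite submxE; have := mulmx_coker (row_mx H^T D).
set K := cokermx _; rewrite -[K]vsubmxK; set U := usubmx K; set V := dsubmx K.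
rewrite !mul_row_col mul0mx add0r -mulmxA => /eqP; rewrite addr_eq0 => /eqP HU.
suff HU0 : H^T *m U = 0.
  by move/eqP: HU; rewrite HU0 eq_sym oppr_eq0 => /eqP ->; rewrite mulmx0.
apply: trmx_inj; rewrite trmx0 trmx_mul trmxK; apply/row_matrixP => i.
rewrite row0 row_mul; apply/eqP/negPn/negP => /HT.
rewrite ltnNge => /negP; apply.
apply: subset_leq_card; apply/subsetP => b; rewrite inE; apply: contraNT => bT.
(* The right-hand side passes through [D], so every row of U^T H vanishes outside [T]. *)
have E : U^T *m H = - (V^T *m D).
  by rewrite -{1}[H]trmxK -trmx_mul HU linearN /= trmx_mul DT.
by rewrite -row_mul E blkE -row_mul mulNmx -mulmxA blkDC // mulmx0 oppr0 row0.
Qed.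

(** Translation by the codeword [x0] carries the codewords vanishing on [T] to those agreeing with
    [a] there. *)
Lemma card_agree (T : {set block s n}) (a : word p s n) (x0 : word p s n) :
    x0 \in C -> (forall b, b \in T -> blk x0 b = blk a b) ->
  (\sum_(x | [forall b in T, blk x b == blk a b]) (x \in C))%N
   = (\sum_(x | [forall b in T, blk x b == 0%R]) (x \in C))%N.
Proof.
move=> x0C x0a; rewrite (reindex_inj (addrI x0)) /=.
apply: eq_big => [x | x _]; last by rewrite null_codeD.
apply: eq_forallb => b; case bT: (b \in T) => //=.
by rewrite blkD x0a // addrC -subr_eq0 addrK.
Qed.

(** A nonzero yH supported on t blocks is a linear constraint on the symbols there, so some pattern
    is missed. Without such constraints every pattern occurs, and by translation all occur equally
    often. *)
Lemma null_code_OA (t : nat) (p_prime : prime p) :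
  is_OA C t <-> (t <= #|block s n|)%N /\
    forall y : 'rV_m, y *m H != 0 -> (t < weight (y *m H))%N.
Proof.
have cardC : (\sum_x (x \in C) = #|C|)%N by rewrite -sum1_card [RHS]big_mkcond.
have q0 T : (0 < \prod_(b in T : {set block s n}) p ^ bsize b)%N.
  by apply: prodn_gt0 => b; rewrite expn_gt0 prime_gt0.
split=> [[_ tn OA] | [tn HT]]; split=> //.
- move=> y; apply: contraNT; rewrite -leqNgt => yt.
  have [|T /subsetP yT cT] := @superset_card _ [set b | blk (y *m H) b != 0] t.
    by rewrite yt.
  apply/eqP/matrixP => i c; rewrite (ord1 i) mxE.
  (* A codeword agreeing with this unit vector on the support of yH has the same product with yH,
     namely 0; that product is entry c of yH. *)
  pose a : word p s n := delta_mx 0 c.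
  have := OA T cT a; rewrite cardC.
  case: (pickP (fun x => (x \in C) && [forall b in T, blk x b == blk a b]))
      => [x /andP[xC /'forall_implyP xa] _ | no].
    have: (y *m H) *m x^T = 0.
      by move: xC; rewrite inE -mulmxA => /eqP ->; rewrite mulmx0.
    rewrite mulmx_tr_blk => E.
    have: (y *m H) *m a^T = 0.
      rewrite mulmx_tr_blk -[RHS]E; apply: eq_bigr => b _.
      have [/xa/eqP -> // | bT] := boolP (b \in T).
      have := contraNN (yT b) bT; rewrite inE negbK => /eqP ->.
      by rewrite !mul0mx.
    by rewrite trmx_delta -colE => /matrixP/(_ 0 0); rewrite !mxE.
  (* With no such codeword the count would be 0, against the positive value |C| / prod required by
     the array. *)
  rewrite big1 => [/esym/eqP | x xa]; last first.
    by have := no x; rewrite xa andbT => ->.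
  by rewrite mulf_eq0 invr_eq0 !pnatr_eq0 !eqn0Ngt null_code_gt0 q0.
- by rewrite cardC null_code_gt0.
move=> T cT a; rewrite cardC.
have ext (a' : word p s n) : exists2 x, x \in C &
    forall b, b \in T -> blk x b = blk a' b.
  by apply: null_code_extend; rewrite cT.
have [x0 x0C x0a] := ext a; rewrite (card_agree x0C x0a).
set f := (\sum_(x | _) _)%N.
(* Pairs of a word and a codeword agreeing on [T], counted from either side; [f] is the common
   number of codewords per pattern. *)
have fE : (#|{: word p s n}| * f)%N
  = (#|C| * #|[set x : word p s n | [forall b in T, blk x b == 0%R]]|)%N.
  transitivity (\sum_(a' : word p s n)
      \sum_(x | [forall b in T, blk x b == blk a' b]) (x \in C))%N.
    rewrite -sum_nat_const; apply: eq_big => // a' _.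
    by have [x xC xa] := ext a'; rewrite (card_agree xC xa).
  rewrite (exchange_big_dep xpredT) //= -sum_nat_const [RHS]big_mkcond.
  apply: eq_bigr => x _; case xC: (x \in C); last by rewrite big1.
  rewrite (reindex_inj (addrI x)) sum1_card.
  apply: eq_card => a'; rewrite !inE; apply: eq_forallb => b; congr (_ ==> _).
  by rewrite blkD eq_sym -subr_eq0 addrC addKr.
have cw : #|{: word p s n}| = (p ^ len s n)%N.
  by rewrite card_mx card_Fp // mul1n.
have := card_vanishing 'F_p T; rewrite card_Fp // => van.
have p0 : (0 < p ^ len s n)%N by rewrite expn_gt0 prime_gt0.
apply: (canRL (mulfK _)); first by rewrite pnatr_eq0 -lt0n.
rewrite -natrM; congr _%:R; apply/eqP.
by rewrite -(eqn_pmul2l p0) mulnA -cw fE -mulnA van cw mulnC.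
Qed.

End DualDistance.

(** Equality case of a termwise bound, the common tool of the extremal arguments below. *)
Lemma eq_of_ler_sum (R : numDomainType) (I : finType) (f g : I -> R) :
  (forall i, f i <= g i) -> \sum_i g i <= \sum_i f i -> forall i, f i = g i.
Proof.
move=> fg gf i; have := leif_sum (fun i (_ : true) => leif_eq (fg i)).
by case=> fg'; rewrite eq_le fg' gf => /esym/forallP/(_ i)/eqP.
Qed.

(** Double orthogonality: the orthogonal of the orthogonal of the column space is the column space
    itself. *)
Lemma kermx_mul_eq0 (F : fieldType) m c (A : 'M[F]_(m, c)) (h : 'cV[F]_m) :
  (kermx A *m h == 0) = (h^T <= A^T)%MS.
Proof.
apply/eqP/idP => [Kh | /submxP[u hu]]; last first.
  by rewrite -[h]trmxK hu trmx_mul trmxK mulmxA mulmx_ker mul0mx.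
have /submxP[X KX]: ((cokermx A^T)^T <= kermx A)%MS.
  by rewrite sub_kermx -{2}[A]trmxK -trmx_mul mulmx_coker trmx0.
by rewrite submxE -trmx_eq0 trmx_mul trmxK KX -mulmxA Kh mulmx0.
Qed.

(** * Arithmetic of the parameters *)

Section CodeNumbers.
Variables (p s m : nat) (n : nat -> nat).
Hypothesis p_prime : prime p.
Local Notation P := (p%:R : rat).

(** This is n/q, kept as a sum over blocks for termwise comparison with sums involving ranks. *)
Definition inv_sizes : rat := \sum_(b : block s n) P ^- bsize b.
Local Notation N := (#|block s n|%:R : rat).

Lemma natp_gt1 : 1 < P.
Proof. by rewrite ltr1n prime_gt1. Qed.

Lemma natp_neq0 : P != 0.
Proof. by rewrite pnatr_eq0 -lt0n prime_gt0. Qed.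

Lemma natr_expB a b : (a <= b)%N -> (p ^ (b - a))%:R = P ^+ b * P ^- a.
Proof.
move=> ab; rewrite -{2}(subnK ab) exprD mulfK ?natrX //.
by rewrite expf_neq0 ?natp_neq0.
Qed.

Lemma ler_expV a b : (P ^- a <= P ^- b) = (b <= a)%N.
Proof.
rewrite lef_pV2 ?posrE ?exprn_gt0 ?(lt_trans ltr01 natp_gt1) //.
by rewrite ler_eXn2l ?natp_gt1.
Qed.

Lemma degreeE : (degree p s n)%:R = P ^+ s * (N - inv_sizes).
Proof.
have ->: degree p s n = (\sum_(b : block s n) (p ^ s - p ^ (s - bsize b)))%N.
  rewrite (@big_block s n _ _ _ (fun i => p ^ s - p ^ (s - i))%N).
  by apply: eq_bigr => i _; rewrite sum_nat_const card_ord.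
rewrite natr_sum mulrBr mulr_sumr -sumr_const mulr_sumr -sumrB.
apply: eq_bigr => b _; rewrite natrB ?natr_expB ?bsize_le ?mulr1 ?natrX //.
by rewrite leq_exp2l ?prime_gt1 // leq_subr.
Qed.

Lemma pmsE : pms p s m = P ^+ m / P ^+ s.
Proof. by rewrite /pms expfzDr ?natp_neq0 // -exprnN. Qed.

Lemma muE : mu p s m n = P ^+ s * (N - inv_sizes) / (P ^+ m - 1).
Proof. by rewrite /mu degreeE. Qed.

(** The average weight of yH over nonzero y when all blocks of H have full rank; it equals mu
    p^(m-s). *)
Definition dual_weight : rat := P ^+ m * (N - inv_sizes) / (P ^+ m - 1).

Lemma mu_pms : mu p s m n * pms p s m = dual_weight.
Proof.
rewrite muE pmsE /dual_weight; have := expf_neq0 s natp_neq0.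
by set a := P ^+ s; set c := (_ - 1)^-1 => a0; field.
Qed.

Lemma nuE : nu p s m n = N - dual_weight.
Proof. by rewrite /nu -card_block mulrC mu_pms. Qed.

Hypothesis m_gt0 : (0 < m)%N.

Lemma expm_gt1 : 1 < P ^+ m.
Proof. by rewrite exprn_egt1 ?natp_gt1 // -lt0n. Qed.

Lemma dual_weightM : (P ^+ m - 1) * dual_weight = P ^+ m * (N - inv_sizes).
Proof.
rewrite mulrC /dual_weight divfK // subr_eq0.
by rewrite gt_eqF // expm_gt1.
Qed.

Lemma muM : (P ^+ m - 1) * mu p s m n = P ^+ s * (N - inv_sizes).
Proof.
rewrite mulrC muE divfK // subr_eq0.
by rewrite gt_eqF // expm_gt1.
Qed.

(** Since k = (p^m - 1) mu, the numerator mu + k is p^m mu. *)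
Lemma strengthE :
  (mu p s m n + (degree p s n)%:R) / P ^+ s - 1 = dual_weight - 1.
Proof.
rewrite -mu_pms pmsE degreeE -muM; have := expf_neq0 s natp_neq0.
by set a := P ^+ s; set c := P ^+ m => a0; field.
Qed.

Hypotheses (s_gt0 : (0 < s)%N) (ns_gt0 : (0 < n s)%N).

Lemma block_gt0 : (0 < #|block s n|)%N.
Proof.
by rewrite card_block /blocks big_nat_recr //= addn_gt0 ns_gt0 orbT.
Qed.

Lemma inv_sizes_lt : inv_sizes < N.
Proof.
have [b _] := card_gt0P block_gt0.
have ->: N = \sum_(b : block s n) 1 by rewrite sumr_const.
apply: ltr_sum => [|c _].
  by apply/hasP; exists b; rewrite ?mem_index_enum.
rewrite invf_lt1 ?exprn_gt0 ?(lt_trans ltr01 natp_gt1) //.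
by rewrite exprn_egt1 ?natp_gt1.
Qed.

Lemma mu_gt0 : 0 < mu p s m n.
Proof.
rewrite muE divr_gt0 ?subr_gt0 ?expm_gt1 // mulr_gt0 ?subr_gt0 ?inv_sizes_lt //.
by rewrite exprn_gt0 ?(lt_trans ltr01 natp_gt1).
Qed.

Lemma degree_gt0 : (0 : rat) < (degree p s n)%:R.
Proof.
rewrite degreeE mulr_gt0 ?subr_gt0 ?inv_sizes_lt //.
by rewrite exprn_gt0 ?(lt_trans ltr01 natp_gt1).
Qed.

Lemma BF_boundE t :
  BF_bound p s n t = P ^+ len s n * (1 - (N - inv_sizes) / t.+1%:R).
Proof.
have N0 : N != 0 by rewrite pnatr_eq0 -lt0n block_gt0.
rewrite /BF_bound /inv_q -card_block; congr (_ * (1 - _)).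
  rewrite -natrX -sum_bsize expn_sum (@big_block s n _ _ _ (fun i => p ^ i)%N).
  by congr _%:R; apply: eq_bigr => i _; rewrite prod_nat_const card_ord.
have ->: inv_sizes = \sum_(1 <= i < s.+1) (n i)%:R / (p ^ i)%:R.
  rewrite /inv_sizes (@big_block s n _ _ _ (fun i => P ^- i)).
  apply: eq_bigr => i _.
  by rewrite sumr_const card_ord mulr_natl natrX.
by rewrite mulrA; congr (_ / _); rewrite mulrBl mul1r mulrAC mulVf // mul1r.
Qed.

(** After cancelling p^len, the equality p^-m = 1 - (N - n/q)/(t+1) rearranges to t + 1 =
    [dual_weight]. *)
Lemma BF_bound_attained t :
  P ^+ len s n * P ^- m = BF_bound p s n t <-> t%:R = dual_weight - 1.
Proof.
rewrite BF_boundE; have M1 := expm_gt1; have := dual_weightM.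
have t0 : t.+1%:R != 0 :> rat by rewrite pnatr_eq0.
have M0 : P ^+ m != 0 by rewrite gt_eqF // (lt_trans ltr01).
have l0 : P ^+ len s n != 0 by rewrite expf_neq0 ?natp_neq0.
move=> wM; have : t.+1%:R = t%:R + 1 :> rat by rewrite natr1.
move: t0 wM M0 M1; set T := t.+1%:R; set M := P ^+ m; set D := N - _.
set W := dual_weight; set l := P ^+ len s n in l0 *.
move=> t0 wM M0 M1 Tt; clearbody T M D l W; split=> [/(mulfI l0) E | E].
  have: M * T * (M^-1) = M * T * (1 - D / T) by rewrite E.
  have ->: M * T * M^-1 = T by field.
  have ->: M * T * (1 - D / T) = M * T - M * D by field.
  have M1' : M - 1 != 0 by lra.
  rewrite -wM => E'; have /(mulfI M1') TW : (M - 1) * T = (M - 1) * W by lra.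
  by rewrite -TW Tt addrK.
congr (_ * _); apply: (mulfI (mulf_neq0 M0 t0)).
have ->: M * T * M^-1 = T by field.
have ->: M * T * (1 - D / T) = M * T - M * D by field.
have ->: T = W by lra.
by rewrite -wM; ring.
Qed.

End CodeNumbers.

(** * Block spaces, covers and weights *)

Section BlockSpaces.
Variables (p s m : nat) (n : nat -> nat) (H : 'M['F_p]_(m, len s n)).
Implicit Types (b : block s n) (v : 'cV['F_p]_m).

Lemma mem_block_space b v :
  (v \in block_space H b) = (v^T <= (blk H b)^T)%MS.
Proof.
apply/idP/idP => [|/submxP[u vu]].
  rewrite /block_space; set X := map _ _.
  move=> /(@coord_span _ _ _ (in_tuple X)) ->; rewrite linear_sum /=.
  apply: summx_sub => i _; rewrite linearZ /=; apply: scalemx_sub.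
  have /mapP[l _ ->] : X`_i \in X by rewrite mem_nth.
  by rewrite tr_col row_sub.
have ->: v = \sum_l u 0 l *: col l (blk H b).
  apply: trmx_inj; rewrite vu mulmx_sum_row linear_sum /=.
  by apply: eq_bigr => l _; rewrite linearZ /= tr_col.
apply: rpred_sum => l _; apply/memvZ/memv_span.
by apply: (map_f (fun l => col l (blk H b))); rewrite mem_enum.
Qed.

Lemma mem_dual_block_space b v :
  (v \in dual_space (block_space H b)) = (v^T *m blk H b == 0).
Proof.
rewrite -trmx_eq0 trmx_mul trmxK; apply/idP/eqP => [/mem_dual_space vU | vA].
  apply/row_matrixP => l; rewrite row_mul row0 -tr_col; apply: vU.
  apply: memv_span; apply: (map_f (fun l => col l (blk H b))).
  by rewrite mem_enum.
apply/mem_dual_space => u; rewrite mem_block_space => /submxP[x ->].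
by rewrite -mulmxA vA mulmx0.
Qed.

Lemma count_space_multiset v :
  count (fun U : {vspace 'cV['F_p]_m} => v \in U) (space_multiset H)
    = (\sum_(b | (v^T <= (blk H b)^T)%MS) p ^ (s - bsize b))%N.
Proof.
rewrite count_flatten -map_comp sumnE big_map big_enum [RHS]big_mkcond /=.
apply: eq_bigr => b _; rewrite count_nseq mem_block_space.
by case: ifP; rewrite ?mul1n.
Qed.

Lemma count_dual_multiset v :
  (count (fun U : {vspace 'cV['F_p]_m} => v \in U) (dual_multiset H)
    + weight (v^T *m H) = #|block s n|)%N.
Proof.
have ->: #|block s n| = (#|[set b | v^T *m blk H b == 0%R]|
    + #|~: [set b | v^T *m blk H b == 0%R]|)%N by rewrite cardsC.
congr (_ + _)%N.
  rewrite count_map -sum1_count big_enum_cond -sum1_card.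
  by apply: eq_bigl => b; rewrite !inE /= mem_dual_block_space.
by apply: eq_card => b; rewrite !inE blkM.
Qed.

Definition full_blocks : Prop := forall b, \rank (blk H b) = bsize b.

(** Common form of the array, one-weight and dual-partition conditions. *)
Definition constant_weight : Prop := forall y : 'rV_m, y != 0 ->
  (weight (y *m H))%:R = dual_weight p s m n.

(** Common form of the partition and completely regular conditions. *)
Definition constant_cover : Prop := forall h : 'rV_m, h != 0 ->
  \sum_(b | (h <= (blk H b)^T)%MS) (p ^ (s - bsize b))%:R = mu p s m n.

Lemma fold_partition_space :
  fold_partition fullv (space_multiset H) (mu p s m n) <-> constant_cover.
Proof.
split=> [[_ cov] h h0 | cov]; last first.
  split=> [U _ | v _ v0]; first exact: subvf.
  by rewrite count_space_multiset natr_sum cov ?trmx_eq0.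
by rewrite -(cov h^T) ?memvf ?trmx_eq0 // count_space_multiset natr_sum trmxK.
Qed.

Hypotheses (p_prime : prime p) (m_gt0 : (0 < m)%N).
Local Notation P := (p%:R : rat).
Local Notation N := (#|block s n|%:R : rat).

Lemma fold_partition_dual :
  fold_partition fullv (dual_multiset H) (nu p s m n) <-> constant_weight.
Proof.
have E v :
    (count (fun U : {vspace 'cV['F_p]_m} => v \in U) (dual_multiset H))%:R
    = N - (weight (v^T *m H))%:R :> rat.
  by rewrite -(count_dual_multiset v) natrD addrK.
rewrite nuE //; split=> [[_ cov] y y0 | cov].
  have := cov y^T (memvf _); rewrite trmx_eq0 E trmxK => /(_ y0).
  by move/addrI/oppr_inj.
split=> [U _ | v _ v0]; first exact: subvf.
by rewrite E cov // trmx_eq0.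
Qed.

(** The symbols occurring in block b are the products y H_b, which exhaust the alphabet exactly when
    H_b has full column rank. *)
Lemma alphabet_effectiveE : alphabet_effective (row_code H) <-> full_blocks.
Proof.
split=> [eff b | full b a].
  apply/eqP; rewrite -/(row_full _) -sub1mx; apply/row_subP => l.
  have [x] := eff b (row l 1%:M); rewrite inE => /submxP[y ->] <-.
  by rewrite blkM submxMl.
have /row_fullP[B BA]: row_full (blk H b) by apply/eqP; exact: full.
exists (a *m B *m H); first by rewrite inE submxMl.
by rewrite blkM -mulmxA BA mulmx1.
Qed.

(** A rank is at most the block size, so the reverse inequality holds termwise and equality is
    forced. *)
Lemma full_blocks_of_sum :
  \sum_b P ^- \rank (blk H b) <= inv_sizes p s n -> full_blocks.
Proof.
move=> le b; apply/eqP; rewrite eqn_leq rank_leq_col /=.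
rewrite -(ler_expV p_prime).
have <- // : P ^- bsize b = P ^- \rank (blk H b).
apply: (eq_of_ler_sum _ le) => c.
by rewrite ler_expV // rank_leq_col.
Qed.

(** Block b of yH vanishes for exactly p^(m - rank H_b) of the p^m vectors y. *)
Lemma sum_weight :
  \sum_(y : 'rV_m) (weight (y *m H))%:R
    = P ^+ m * (N - \sum_b P ^- \rank (blk H b)).
Proof.
have ->: \sum_(y : 'rV_m) (weight (y *m H))%:R
   = \sum_(b : block s n) \sum_(y : 'rV['F_p]_m | y *m blk H b != 0) 1 :> rat.
  rewrite (exchange_big_dep xpredT) //=; apply: eq_bigr => y _.
  by rewrite /weight -sum1_card natr_sum; apply: eq_bigl => b; rewrite inE blkM.
rewrite mulrBr mulr_sumr -sumr_const mulr_sumr -sumrB.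
apply: eq_bigr => b _; rewrite mulr1 -natr_expB ?rank_leq_row //.
have ->: (p ^ (m - \rank (blk H b)))%N
    = #|[set y : 'rV_m | y *m blk H b == 0%R]|.
  by rewrite card_left_kernel card_Fp.
have ->: P ^+ m = #|{: 'rV['F_p]_m}|%:R.
  by rewrite card_mx card_Fp // mul1n natrX.
rewrite -(cardsC [set y : 'rV['F_p]_m | y *m blk H b == 0]).
rewrite natrD addrAC subrr add0r.
by rewrite -sum1_card natr_sum; apply: eq_bigl => y; rewrite !inE.
Qed.

Lemma sum_const_weight (f : 'rV['F_p]_m -> rat) c : f 0 = 0 ->
  (forall y, y != 0 -> f y = c) -> \sum_y f y = (P ^+ m - 1) * c.
Proof.
move=> f0 fc.
have := @sumr_const_nonzero _ _ setT f c (in_setT _) fc.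
rewrite f0 add0r cardsT card_mx card_Fp // mul1n natrX => <-.
by apply: eq_bigl => y; rewrite inE.
Qed.

Lemma weight0 : weight (0 : word p s n) = 0%N.
Proof. by apply: eq_card0 => b; rewrite !inE blk0 eqxx. Qed.

(** The prescribed weight fixes the total weight, hence the sum of the p^-rank, at its full-rank
    value. *)
Lemma full_blocks_of_weight : constant_weight -> full_blocks.
Proof.
move=> cw; apply: full_blocks_of_sum.
have := sum_const_weight (f := fun y => (weight (y *m H))%:R) _ cw.
rewrite mul0mx weight0 sum_weight dual_weightM // => /(_ erefl).
move/(mulfI (expf_neq0 m (natp_neq0 p_prime)))/addrI/oppr_inj.
by move=> ->.
Qed.

(** Counting all incidences and dividing by p^s shows that the numbers p^(rank - size), each at most
    1, sum to the number of blocks. *)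
Lemma full_blocks_of_cover : constant_cover -> full_blocks.
Proof.
move=> cov b; apply/eqP; rewrite eqn_leq rank_leq_col /=.
have := sum_cover_orthogonal cov 0.
under eq_bigr do rewrite mulmx0 eqxx divr1 mxrank_tr card_Fp //.
rewrite card_left_kernel mxrank0 subn0 card_Fp // natrX muM //.
have S0 : P ^+ s != 0 by rewrite expf_neq0 ?natp_neq0.
under eq_bigr do rewrite natr_expB ?bsize_le // -mulrA.
under [in RHS]eq_bigr do rewrite natr_expB ?bsize_le //.
rewrite -!mulr_sumr -mulrDr addrC subrK => /(mulfI S0) E.
have : P ^- bsize b * P ^+ \rank (blk H b) = 1.
  apply: (@eq_of_ler_sum _ _
    (fun b => P ^- bsize b * P ^+ \rank (blk H b)) (fun=> 1)).
    move=> c; rewrite mulrC ler_pdivrMr; last first.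
      by rewrite exprn_gt0 // (lt_trans ltr01 (natp_gt1 p_prime)).
    by rewrite mul1r ler_eXn2l ?natp_gt1 // rank_leq_col.
  by rewrite E sumr_const.
have B0 : P ^+ bsize b != 0 by rewrite expf_neq0 ?natp_neq0.
move/(congr1 ( *%R (P ^+ bsize b))); rewrite mulVKf // mulr1 => E'.
by rewrite -(ler_eXn2l (natp_gt1 p_prime)) E'.
Qed.

(** * Duality between constant covers and constant weights *)

Lemma sum_orthogonal_blocks (y : 'rV_m) :
  \sum_(b | y *m blk H b == 0) 1 = N - (weight (y *m H))%:R.
Proof.
rewrite -[y]trmxK -(count_dual_multiset y^T) trmxK natrD addrK.
rewrite count_map -sum1_count big_enum_cond natr_sum.
by apply: eq_bigl => b; rewrite /= mem_dual_block_space trmxK.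
Qed.

(** Poisson summation for the H_b with weights p^(s-i): by full rank each block orthogonal to y
    contributes p^(s-i) p^i = p^s, so their number is determined. *)
Lemma constant_cover_weight : constant_cover -> constant_weight.
Proof.
move=> cov y y0; have full := full_blocks_of_cover cov.
have S0 := expf_neq0 s (natp_neq0 p_prime).
have yT0 : y^T != 0 by rewrite trmx_eq0.
have : P ^+ s * (N - (weight (y *m H))%:R)
    = P ^+ s * inv_sizes p s n - mu p s m n.
  rewrite -sum_orthogonal_blocks !mulr_sumr.
  have <- : \sum_(b : block s n) (p ^ (s - bsize b))%:R
          = \sum_(b : block s n) P ^+ s * P ^- bsize b.
    by apply: eq_bigr => b _; rewrite natr_expB ?bsize_le.
  rewrite -(dual_cover cov yT0); apply: eq_big => b.
    by rewrite -trmx_mul trmx_eq0.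
  move=> _; rewrite mxrank_tr full natr_expB ?bsize_le // card_Fp //.
  rewrite mulfVK ?mulr1 //.
  by rewrite expf_neq0 ?natp_neq0.
have := muM s n p_prime m_gt0.
rewrite -(mu_pms s m n p_prime) pmsE //.
move: S0; set S := P ^+ s; set M := P ^+ m; set mu0 := mu _ _ _ _.
set wt := (weight _)%:R => S0 Emu E.
apply: (mulfI S0); rewrite [S * (mu0 * _)]mulrCA [S * (M / S)]mulrCA.
rewrite divff // mulr1.
lra.
Qed.

(** Poisson summation for the duals with weight 1: a block space of dimension i containing h
    contributes p^(m-i), and rescaling by p^(s-m) gives the multiplicity p^(s-i). *)
Lemma constant_weight_cover : constant_weight -> constant_cover.
Proof.
move=> cw h h0; have full := full_blocks_of_weight cw.
have cov (y : 'rV_m) : y != 0 ->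
    \sum_(b | (y <= kermx (blk H b))%MS) 1 = nu p s m n.
  move=> y0; rewrite nuE // -(cw y y0) -sum_orthogonal_blocks.
  by apply: eq_bigl => b; rewrite sub_kermx.
have hT0 : h^T != 0 by rewrite trmx_eq0.
have := dual_cover cov hT0.
have ->: \sum_(b : block s n) 1 = N :> rat by rewrite sumr_const.
rewrite nuE // opprB addrC subrK -(mu_pms s m n p_prime) pmsE //.
have S0 := expf_neq0 s (natp_neq0 p_prime).
have M0 := expf_neq0 m (natp_neq0 p_prime).
set Q := \sum_(b | (h <= (blk H b)^T)%MS) P ^- bsize b.
have ->: \sum_(b | kermx (blk H b) *m h^T == 0)
    1 * #|'F_p|%:R ^+ \rank (kermx (blk H b)) = P ^+ m * Q.
  rewrite mulr_sumr; apply: eq_big => b; first by rewrite kermx_mul_eq0 trmxK.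
  move=> _; rewrite mul1r mxrank_ker full card_Fp // -natrX natr_expB //.
  by rewrite -(full b) rank_leq_row.
move=> E; have ->: \sum_(b | (h <= (blk H b)^T)%MS) (p ^ (s - bsize b))%:R
    = P ^+ s * Q.
  by rewrite mulr_sumr; apply: eq_bigr => b _; rewrite natr_expB ?bsize_le.
apply: (mulfI M0); rewrite mulrCA E; move: M0 S0.
by set S := P ^+ s; set M := P ^+ m => M0 S0; field.
Qed.

End BlockSpaces.

(** * Edges of the multigraph and syndromes *)

Section HammingEdges.
Variables (p s m : nat) (n : nat -> nat) (H : 'M['F_p]_(m, len s n)).
Hypotheses (p_prime : prime p) (m_gt0 : (0 < m)%N).
Local Notation C := (null_code H).
Local Notation e := (@hamming_edges p s n).
Local Notation P := (p%:R : rat).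
Local Notation N := (#|block s n|%:R : rat).

Lemma hamming_edgesD (x z : word p s n) : e x (x + z) = e 0 z.
Proof.
apply: eq_bigl => b; congr (_ == _); apply/setP => b'.
by rewrite !inE blk0 blkD -subr_eq0 opprD addNKr oppr_eq0 eq_sym.
Qed.

(** The neighbours of x through block b are obtained by adding a nonzero symbol u in that block. *)
Lemma sum_hamming_edges (x : word p s n) (Q : pred (word p s n)) :
  (\sum_(y | Q y) e x y
     = \sum_b p ^ (s - bsize b)
         * #|[set u : 'rV_(bsize b)
               | (u != 0%R) && Q (x + u *m (proj _ b)^T)%R]|)%N.
Proof.
rewrite (reindex_inj (addrI x)) /=; under eq_bigr do rewrite hamming_edgesD.
rewrite (exchange_big_dep xpredT) //=; apply: eq_bigr => b _.
rewrite mulnC -sum_nat_const.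
rewrite (reindex_onto (fun u : 'rV_(bsize b) => u *m (proj _ b)^T)
                      (fun z => blk z b)) /= => [|z /andP[_ /eqP zb]].
  apply: eq_bigl => u; rewrite inE blkM blk_tr_proj mulmx1 eqxx andbT andbC.
  congr (_ && _); apply/eqP/idP => [ub | u0].
    have: b \in [set b] by rewrite inE.
    by rewrite -ub inE blk0 blkM blk_tr_proj mulmx1 eq_sym.
  apply/setP => b'; rewrite !inE blk0 blkM eq_sym.
  have [-> | b'b] := eqVneq b' b; first by rewrite blk_tr_proj mulmx1.
  by rewrite blk_tr_proj_neq // mulmx0 eqxx.
apply: blk_inj => b'; rewrite blkM.
have [-> | b'b] := eqVneq b' b; first by rewrite blk_tr_proj mulmx1.
rewrite blk_tr_proj_neq // mulmx0; apply/eqP.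
have: b' \notin [set b] by rewrite inE.
by rewrite -zb inE blk0 negbK.
Qed.

Lemma regular_hamming : regular_multigraph e.
Proof.
exists (\sum_y e 0%R y)%N => x; rewrite (reindex_inj (addrI x)) /=.
by apply: eq_bigr => z _; rewrite hamming_edgesD.
Qed.

Lemma mem_null_code_shift (x : word p s n) b (u : 'rV_(bsize b)) :
  (x + u *m (proj _ b)^T \in C) = (u *m (blk H b)^T == - (x *m H^T)).
Proof.
rewrite mem_null_code mulmxDl -mulmxA -trmx_mul -blkE addrC.
by rewrite addr_eq0.
Qed.

(** A change u in block b stays in the code iff H_b kills u, so p^i - p^(i - rank) changes leave it,
    each along p^(s-i) edges. *)
Lemma sum_edges_out (x : word p s n) : x \in C ->
  (\sum_(y | y \notin C) e x y)%:R
    = P ^+ s * (N - \sum_b P ^- \rank (blk H b)) :> rat.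
Proof.
rewrite mem_null_code => /eqP xC; rewrite sum_hamming_edges natr_sum.
rewrite mulrBr mulr_sumr -sumr_const mulr_sumr -sumrB.
apply: eq_bigr => b _; rewrite natrM natr_expB ?bsize_le // mulr1.
set U := [set u | _].
have ->: #|U|%:R = P ^+ bsize b - P ^+ bsize b * P ^- \rank (blk H b).
  rewrite -natr_expB ?rank_leq_col //.
  have ->: (p ^ (bsize b - \rank (blk H b)))%N
      = #|[set u : 'rV['F_p]_(bsize b) | u *m (blk H b)^T == 0%R]|.
    by rewrite card_left_kernel mxrank_tr card_Fp.
  have ->: P ^+ bsize b = #|{: 'rV['F_p]_(bsize b)}|%:R.
    by rewrite card_mx mul1n card_Fp ?natrX.
  rewrite -(cardsC [set u : 'rV['F_p]_(bsize b) | u *m (blk H b)^T == 0]).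
  rewrite natrD addrAC subrr add0r; congr _%:R; apply: eq_card => u.
  rewrite in_set mem_null_code_shift xC oppr0 !inE.
  by have [-> | //] := eqVneq u 0; rewrite mul0mx eqxx.
have B0 : P ^+ bsize b != 0 by rewrite expf_neq0 ?natp_neq0.
by rewrite mulrBr mulrA !mulfVK.
Qed.

(** Entering the code through block b means cancelling the syndrome by a combination of the columns
    of H_b; full rank makes that combination unique. *)
Lemma sum_edges_in (x : word p s n) : full_blocks H -> x \notin C ->
  (\sum_(y in C) e x y)%N
    = (\sum_(b | (- (x *m H^T) <= (blk H b)^T)%MS) p ^ (s - bsize b))%N.
Proof.
move=> full; rewrite mem_null_code => xC.
rewrite sum_hamming_edges [RHS]big_mkcond; apply: eq_bigr => b _.
set U := [set u | _].
have UE u : (u \in U) = (u *m (blk H b)^T == - (x *m H^T)).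
  rewrite in_set mem_null_code_shift; case: eqVneq => //= ->.
  by rewrite mul0mx eq_sym oppr_eq0 (negPf xC).
case: ifP => [/submxP[u hu] | nsub].
  have ->: U = [set u]; last by rewrite cards1 muln1.
  apply/setP => v; rewrite UE hu inE.
  have /row_free_inj inj : row_free (blk H b)^T.
    by rewrite /row_free mxrank_tr full.
  by apply/eqP/eqP => [/inj | ->].
have ->: U = set0; last by rewrite cards0 muln0.
apply/setP => u; rewrite UE inE; apply/eqP => hu.
by rewrite -hu submxMl in nsub.
Qed.

Hypotheses (s_gt0 : (0 < s)%N) (ns_gt0 : (0 < n s)%N).
Hypothesis rankH : \rank H = m.

(** The outgoing degree k forces full rank; then the ingoing degree at x is the cover multiplicity
    at minus the syndrome of x. *)
Lemma CR_code_cover :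
  CR_code e C (degree p s n)%:R (mu p s m n) <-> constant_cover H.
Proof.
split=> [[_ _ out inn] | cov].
  have full : full_blocks H.
    apply: full_blocks_of_sum => //.
    have C0 : 0 \in C by rewrite mem_null_code mul0mx.
    have := out 0 C0; rewrite (sum_edges_out C0) degreeE //.
    by move/(mulfI (expf_neq0 s (natp_neq0 p_prime)))/addrI/oppr_inj => ->.
  move=> h h0; have /row_fullP[B BH] : row_full H^T.
    by rewrite /row_full mxrank_tr rankH.
  (* Since H has rank m, every vector is a syndrome; this word has syndrome -h. *)
  pose x : word p s n := - h *m B.
  have xh : - (x *m H^T) = h by rewrite -mulmxA BH mulmx1 opprK.
  have xC : x \notin C by rewrite mem_null_code -oppr_eq0 xh.
  by have := inn x xC; rewrite sum_edges_in // xh natr_sum.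
have full := full_blocks_of_cover p_prime m_gt0 cov.
split=> [||x xC|x xC].
- exact: regular_hamming.
- by rewrite degree_gt0 ?mu_gt0.
- rewrite sum_edges_out // degreeE //; congr (_ * (_ - _)).
  by apply: eq_bigr => b _; rewrite full.
rewrite sum_edges_in // natr_sum; apply: cov.
by rewrite oppr_eq0 -mem_null_code.
Qed.

(** * One-weight codes and extremal orthogonal arrays *)

Lemma mulH_eq0 (y : 'rV_m) : (y *m H == 0) = (y == 0).
Proof. by rewrite mulmx_free_eq0 // /row_free rankH. Qed.

Lemma one_weightE :
  one_weight (row_code H) (dual_weight p s m n) <-> constant_weight H.
Proof.
split=> [ow y y0 | cw x].
  by apply: ow; rewrite ?inE ?submxMl // mulH_eq0.
by rewrite inE => /submxP[y ->]; rewrite mulH_eq0; apply: cw.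
Qed.

(** Strength [dual_weight] - 1 bounds every nonzero weight below by [dual_weight], while rank at
    most size bounds their average above by it. *)
Lemma OA_constant_weight :
  (exists t : nat, t%:R = dual_weight p s m n - 1 /\ is_OA C t)
    <-> constant_weight H.
Proof.
split=> [[t [tw /(null_code_OA H t p_prime)[_ wt]]] y y0 | cw].
  have wE : dual_weight p s m n = t.+1%:R by rewrite -natr1 tw subrK.
  (* The value 0 at y = 0 makes this a lower bound for the weight on all of F_p^m. *)
  pose f (y : 'rV['F_p]_m) : rat := if y == 0 then 0 else dual_weight p s m n.
  have le_f x : f x <= (weight (x *m H))%:R.
    rewrite /f; case: eqVneq => [_|x0]; first exact: ler0n.
    by rewrite wE ler_nat wt // mulH_eq0.
  suff le_sum : \sum_x (weight (x *m H))%:R <= \sum_x f x.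
    by rewrite -(eq_of_ler_sum le_f le_sum) /f (negPf y0).
  rewrite (sum_const_weight p_prime (f := f) (c := dual_weight p s m n));
    first last.
  - by move=> x /negPf x0; rewrite /f x0.
  - by rewrite /f eqxx.
  rewrite sum_weight // dual_weightM // ler_pM2l; last first.
    by rewrite exprn_gt0 // (lt_trans ltr01 (natp_gt1 p_prime)).
  rewrite lerD2l lerN2; apply: ler_sum => b _.
  by rewrite ler_expV // rank_leq_col.
have [y y0]: exists y : 'rV['F_p]_m, y != 0.
  by exists (delta_mx 0 (Ordinal m_gt0)); rewrite -mxrank_eq0 mxrank_delta.
have w0 : (0 < weight (y *m H))%N.
  rewrite -(ltr0n rat) cw // -mu_pms // mulr_gt0 ?mu_gt0 // pmsE //.
  by rewrite divr_gt0 // exprn_gt0 // (lt_trans ltr01 (natp_gt1 p_prime)).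
(* An actual weight witnesses that [dual_weight] is an integer; its positivity makes the predecessor
   exact. *)
exists (weight (y *m H)).-1; split.
  by rewrite -(cw y y0) -{2}(prednK w0) -natr1 addrK.
apply/null_code_OA => //; split=> [|x].
  by rewrite (leq_trans (leq_pred _)) ?max_card.
rewrite mulH_eq0 => x0; rewrite prednK //.
by rewrite -(ler_nat rat) !cw.
Qed.

Lemma card_null_code : #|C|%:R = P ^+ len s n * P ^- m.
Proof.
rewrite -natr_expB //; last by rewrite -rankH rank_leq_col.
have ->: (p ^ (len s n - m))%N = #|[set x : word p s n | x *m H^T == 0%R]|.
  by rewrite card_left_kernel mxrank_tr rankH card_Fp.
by congr _%:R; apply: eq_card => x; rewrite mem_null_code inE.
Qed.

End HammingEdges.

Theorem theorem14 (p s m : nat) (n : nat -> nat)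
    (p_prime : prime p) (s_gt0 : (1 <= s)%N) (m_gt0 : (1 <= m)%N)
    (ns_gt0 : (1 <= n s)%N)
    (H : 'M['F_p]_(m, len s n)) (rankH : \rank H = m) :
  let C := null_code H in
  let k := (degree p s n)%:R : rat in
  let mu := mu p s m n in
  [<->
    (* (i) *)
    exists t : nat, is_OA C t /\ #|C|%:R = BF_bound p s n t;
    (* (i') *)
    exists t : nat, t%:R = (mu + k) / p%:R ^+ s - 1 /\ is_OA C t;
    (* (ii) *)
    CR_code (@hamming_edges p s n) C k mu;
    (* (iii) *)
    alphabet_effective (row_code H) /\
      one_weight (row_code H) (mu * pms p s m);
    (* (iv) *)
    fold_partition fullv (space_multiset H) mu;
    (* (v) *)
    fold_partition fullv (dual_multiset H) (nu p s m n)
  ].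
Proof.
move=> C k mu0; rewrite /k /mu0 strengthE // mu_pms // {k mu0}.
have OAw := OA_constant_weight p_prime m_gt0 s_gt0 ns_gt0 rankH.
have CR := CR_code_cover p_prime m_gt0 s_gt0 ns_gt0 rankH.
have BF t := BF_bound_attained p_prime m_gt0 s_gt0 ns_gt0 t.
(* The implications form the cycle in the listed order, each passing through [constant_weight] or
   [constant_cover], except the first, which only converts the bound into the value of t. *)
tfae.
- by case=> t [OA]; rewrite card_null_code // => /BF tw; exists t.
- by move/OAw => cw; apply/CR; apply: constant_weight_cover.
- move/CR/(constant_cover_weight p_prime m_gt0) => cw; split.
    by apply/alphabet_effectiveE; apply: full_blocks_of_weight.
  exact/(one_weightE rankH).
- case=> _ /(one_weightE rankH) cw; apply/fold_partition_space.
  exact: constant_weight_cover.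
- move/fold_partition_space/(constant_cover_weight p_prime m_gt0) => cw.
  exact/fold_partition_dual.
move/(fold_partition_dual H p_prime)/OAw => [t [tw OA]].
by exists t; rewrite card_null_code //; split=> //; apply/BF.
Qed.
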